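(* Let $(\rho,v)$ be any convex integration realization generated by an admissible piecewise constant fan subsolution, and let $(\rho^{\mathrm{ref}},v^{\mathrm{ref}})$ be a piecewise constant self-similar reference solution with the same Riemann data. Then $$\mathcal E(\rho,v,t)-\mathcal E(\rho^{\mathrm{ref}},v^{\mathrm{ref}},t)=\ell t\,\mathfrak E,\qquad \mathfrak E:=\int_{\mathbb R}\left[H^{\mathrm{fan}}(\xi)-H^{\mathrm{ref}}(\xi)\right]d\xi .$$ Independently of $\ell>0$ and $t>0$, the fan has strictly smaller energy rate than the reference solution if and only if $\mathfrak E<0$, and strictly larger energy rate if and only if $\mathfrak E>0$.
   Context: Pressure law: $p$ is a sufficiently smooth function on $(0,\infty)$ with $p'>0$, and the specific internal energy $e$ satisfies $p(\rho)=\rho^2e'(\rho)$. Isentropic Euler equations in two space dimensions: $\partial_t\rho+\mathrm{div}(\rho v)=0$, $\partial_t(\rho v)+\mathrm{div}(\rho v\otimes v)+\nabla p(\rho)=0$. Energy density: $H(\rho,v)=\tfrac12\rho|v|^2+\rho e(\rho)$. A bounded entropic weak solution is a pair $(\rho,v)\in L^\infty$ with $\rho>0$ a.e. that solves the Euler equations in the sense of distributions and satisfies $\partial_tH+\mathrm{div}((H+p(\rho))v)\le0$ in the sense of distributions. Riemann data: $(\rho_-,v_-)$ for $x_2<0$ and $(\rho_+,v_+)$ for $x_2>0$, with constants $\rho_\pm>0$, $v_\pm\in\mathbb R^2$. Admissible piecewise constant fan subsolution: constants $\rho_i>0$, $v_i\in\mathbb R^2$, $u_i$ a trace-free symmetric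 $2\times2$ real matrix, $C_i>0$ ($i=1,\dots,N$), and speeds $\nu_0<\nu_1<\dots<\nu_N$. Put $P_-=\{t>0,\,x_2<\nu_0t\}$, $P_i=\{t>0,\,\nu_{i-1}t<x_2<\nu_it\}$, $P_+=\{t>0,\,x_2>\nu_Nt\}$, and let $\bar\rho,\bar v,\bar u,\bar C$ be the piecewise constant fields with values $\rho_i,v_i,u_i,C_i$ in $P_i$ and $\rho_\pm,\ v_\pm,\ v_\pm\otimes v_\pm-\tfrac12|v_\pm|^2\mathrm{Id},\ |v_\pm|^2$ in $P_\pm$. One requires $v_i\otimes v_i-u_i<\tfrac{C_i}{2}\mathrm{Id}$ for all $i$; the relaxed equations $\partial_t\bar\rho+\mathrm{div}(\bar\rho\bar v)=0$, $\partial_t(\bar\rho\bar v)+\mathrm{div}(\bar\rho\bar u)+\nabla(p(\bar\rho)+\tfrac12\bar\rho\bar C)=0$ (equivalently, the Rankine–Hugoniot relations at every interface); and the admissibility inequality $\partial_t\bar H+\mathrm{div}((\bar H+p(\bar\rho))\bar v)\le0$ with $\bar H=\tfrac12\bar\rho\bar C+\bar\rho e(\bar\rho)$. A convex integration realization generated by the fan is a bounded entropic weak solution $(\rho,v)$ with the same Riemann data such that $\rho=\bar\rho$ a.e., $v=v_\pm$ in $P_\pm$, and $|v|^2=C_i$ a.e. in $P_i$, $i=1,\dots,N$. A piecewise constant self-similar reference solution is given by a partition $-\infty=\sigma_0<\sigma_1<\dots<\sigma_M=\infty$ and constants $(\rho_j^{\mathrm{ref}},v_j^{\mathrm{ref}})$,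 with $(\rho^{\mathrm{ref}},v^{\mathrm{ref}})(x,t)=(\rho^{\mathrm{ref}}_j,v^{\mathrm{ref}}_j)$ whenever $\sigma_{j-1}<x_2/t<\sigma_j$. Profiles in $\xi=x_2/t$: $H^{\mathrm{ref}}(\xi)=\tfrac12\rho_j^{\mathrm{ref}}|v_j^{\mathrm{ref}}|^2+\rho_j^{\mathrm{ref}}e(\rho_j^{\mathrm{ref}})$ for $\sigma_{j-1}<\xi<\sigma_j$; $H^{\mathrm{fan}}(\xi)=\tfrac12\rho_iC_i+\rho_ie(\rho_i)$ for $\nu_{i-1}<\xi<\nu_i$, and $H^{\mathrm{fan}}(\xi)=\tfrac12\rho_\pm|v_\pm|^2+\rho_\pm e(\rho_\pm)$ for $\xi<\nu_0$ (sign $-$), respectively $\xi>\nu_N$ (sign $+$). Since the Riemann data agree, $H^{\mathrm{fan}}=H^{\mathrm{ref}}$ for $|\xi|$ large. Energy differences are computed on the strip $\Omega_\ell=(\mathbb R/\ell\mathbb Z)\times\mathbb R$, $\ell>0$: $\mathcal E(\rho^{(1)},v^{(1)},t)-\mathcal E(\rho^{(2)},v^{(2)},t)=\int_{\Omega_\ell}[H(\rho^{(1)},v^{(1)})-H(\rho^{(2)},v^{(2)})]\,dx$. ''Strictly smaller (larger) energy rate than the reference'' means that the right time derivative of this difference (fan realization minus reference) is $<0$ ($>0$). For fixed-time statements, the almost-everywhere identities of a realization are understood to hold for a.e. $x$ at the time $t$ considered. *)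

(* Defs.v *)
From HB Require Import structures.
From mathcomp Require Import all_boot all_order all_algebra.
From mathcomp Require Import all_classical all_reals all_analysis.

Set Implicit Arguments.
Unset Strict Implicit.
Unset Printing Implicit Defensive.

Import Order.TTheory GRing.Theory Num.Theory.
Import numFieldNormedType.Exports.

Local Open Scope classical_set_scope.
Local Open Scope ring_scope.

Section Euler.
Context {R : realType}.

(* Space points are [x = (x1, x2)] and space-time points are [z = (x, t)].
   Velocities are row vectors; [`|v|] is the sup norm on ['rV_2], so the
   Euclidean norm is written out. *)

Definition normsq (v : 'rV[R]_2) : R := \sum_(k < 2) v 0 k ^+ 2.

Definition lebesgue2 := (@lebesgue_measure R \x @lebesgue_measure R)%E.
Definition lebesgue3 := (lebesgue2 \x @lebesgue_measure R)%E.

Definition future :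
    set (measurableTypeR R * measurableTypeR R * measurableTypeR R) :=
  [set z | 0 < z.2].

(* "Sufficiently smooth" is taken to be C^1 on ]0, +oo[; the values of [p] and
   [e] on ]-oo, 0] are irrelevant. *)
Definition pressure_law (p e : R -> R) : Prop :=
  [/\ forall r : R, 0 < r -> derivable p r 1 /\ 0 < derive1 p r,
      forall r : R, 0 < r -> {for r, continuous (derive1 p)}
    & forall r : R, 0 < r -> derivable e r 1 /\ p r = r ^+ 2 * derive1 e r].

Definition energy (e : R -> R) (r : R) (v : 'rV[R]_2) : R :=
  2^-1 * r * normsq v + r * e r.

Definition dir_t : R * R * R := (0, 0, 1).
Definition dir_x (j : 'I_2) : R * R * R :=
  if j == ord0 then (1, 0, 0) else (0, 1, 0).

(* C^oo: every iterated directional derivative is differentiable everywhere. *)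
Definition smooth (phi : R * R * R -> R) : Prop :=
  forall (s : seq (R * R * R)) (z : R * R * R),
    differentiable (foldr (fun w g => 'D_w g) phi s) z.

Definition test_function (phi : R * R * R -> R) : Prop :=
  smooth phi /\ compact (closure [set z | phi z != 0]).

(* Distributional pairing of [d_t q + div f] on [0, +oo[ x R^2, with initial
   value [q0], against a test function that need not vanish at [t = 0]; up to
   sign, it is the Cauchy weak formulation. *)
Definition weak_form (q : R * R * R -> R) (f : 'I_2 -> R * R * R -> R)
    (q0 : R * R -> R) (phi : R * R * R -> R) : \bar R :=
  (\int[lebesgue3]_(z in future)
      (q z * 'D_dir_t phi z + \sum_(j < 2) f j z * 'D_(dir_x j) phi z)%:E
   + \int[lebesgue2]_x (q0 x * phi (x, 0))%:E)%E.

Definition conserved q f q0 : Prop :=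
  forall phi, test_function phi -> weak_form q f q0 phi = 0%E.

(* Finiteness is automatic for locally integrable fields; it is required since
   integrals in [\bar R] are total. *)
Definition dissipated q f q0 : Prop :=
  forall phi, test_function phi -> (forall z, 0 <= phi z) ->
    weak_form q f q0 phi \is a fin_num /\ (0 <= weak_form q f q0 phi)%E.

Record riemann_data := RiemannData {
  rho_minus : R; v_minus : 'rV[R]_2;
  rho_plus : R; v_plus : 'rV[R]_2 }.

Definition rho_init (d : riemann_data) (x : R * R) : R :=
  if x.2 < 0 then rho_minus d else rho_plus d.
Definition v_init (d : riemann_data) (x : R * R) : 'rV[R]_2 :=
  if x.2 < 0 then v_minus d else v_plus d.

Definition euler_weak_solution (p : R -> R) (d : riemann_data)
    (rho : R * R * R -> R) (v : R * R * R -> 'rV[R]_2) : Prop :=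
  conserved rho (fun j z => rho z * v z 0 j) (rho_init d) /\
  forall k : 'I_2,
    conserved (fun z => rho z * v z 0 k)
      (fun j z => rho z * v z 0 k * v z 0 j + (j == k)%:R * p (rho z))
      (fun x => rho_init d x * v_init d x 0 k).

Definition bounded_entropic_weak_solution (p e : R -> R) (d : riemann_data)
    (rho : R * R * R -> R) (v : R * R * R -> 'rV[R]_2) : Prop :=
  [/\ measurable_fun future rho /\
        (forall k, measurable_fun future (fun z => v z 0 k)),
      exists K : R, {ae lebesgue3, forall z, future z ->
        `|rho z| <= K /\ forall k, `|v z 0 k| <= K},
      {ae lebesgue3, forall z, future z -> 0 < rho z},
      euler_weak_solution p d rho v
    & dissipated (fun z => energy e (rho z) (v z))
        (fun j z => (energy e (rho z) (v z) + p (rho z)) * v z 0 j)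
        (fun x => energy e (rho_init d x) (v_init d x))].

(* Interval [i : 'I_n] of a subdivision [b 0 < ... < b n] lies between
   [b (left_end i)] and [b (right_end i)]. *)
Definition left_end n (i : 'I_n) : 'I_n.+1 := widen_ord (leqnSn n) i.
Definition right_end n (i : 'I_n) : 'I_n.+1 := lift ord0 i.

Definition posdefmx (A : 'M[R]_2) : Prop :=
  forall w : 'rV[R]_2, w != 0 -> 0 < (w *m A *m w^T) 0 0.

(* [tensor v k j = v k * v j], as [v] is a row vector. *)
Definition tensor (v : 'rV[R]_2) : 'M[R]_2 := v^T *m v.

(* The paper's indices 1, ..., N are shifted to ['I_N]. *)
Record fan (N : nat) := Fan {
  fan_rho : 'I_N -> R;
  fan_v : 'I_N -> 'rV[R]_2;
  fan_u : 'I_N -> 'M[R]_2;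
  fan_C : 'I_N -> R;
  fan_nu : 'I_N.+1 -> R }.

Definition P_minus N (F : fan N) : set (R * R * R) :=
  [set z | 0 < z.2 /\ z.1.2 < fan_nu F ord0 * z.2].
Definition P_mid N (F : fan N) (i : 'I_N) : set (R * R * R) :=
  [set z | [/\ 0 < z.2, fan_nu F (left_end i) * z.2 < z.1.2
             & z.1.2 < fan_nu F (right_end i) * z.2]].
Definition P_plus N (F : fan N) : set (R * R * R) :=
  [set z | 0 < z.2 /\ fan_nu F ord_max * z.2 < z.1.2].

(* Piecewise constant profile in [xi]; the value 0 at the finitely many
   interfaces is immaterial. *)
Definition fan_profile N (F : fan N) (A : zmodType) (am ap : A) (a : 'I_N -> A)
    (xi : R) : A :=
  if xi < fan_nu F ord0 then am
  else if fan_nu F ord_max < xi then ap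
  else if [pick i | fan_nu F (left_end i) < xi < fan_nu F (right_end i)]
       is Some i then a i else 0.

Section FanFields.
Variables (N : nat) (F : fan N) (d : riemann_data).

Definition rho_bar (z : R * R * R) : R :=
  fan_profile F (rho_minus d) (rho_plus d) (fan_rho F) (z.1.2 / z.2).
Definition v_bar (z : R * R * R) : 'rV[R]_2 :=
  fan_profile F (v_minus d) (v_plus d) (fan_v F) (z.1.2 / z.2).
Definition u_bar (z : R * R * R) : 'M[R]_2 :=
  let u v := tensor v - (2^-1 * normsq v)%:M in
  fan_profile F (u (v_minus d)) (u (v_plus d)) (fan_u F) (z.1.2 / z.2).
Definition C_bar (z : R * R * R) : R :=
  fan_profile F (normsq (v_minus d)) (normsq (v_plus d)) (fan_C F)
    (z.1.2 / z.2).
Definition H_bar (e : R -> R) (z : R * R * R) : R :=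
  2^-1 * rho_bar z * C_bar z + rho_bar z * e (rho_bar z).

Definition admissible_fan_subsolution (p e : R -> R) : Prop :=
  [/\ (0 < N)%N /\ {homo fan_nu F : i j / (i < j)%N >-> i < j},
      forall i, [/\ 0 < fan_rho F i, 0 < fan_C F i,
        (fan_u F i)^T = fan_u F i, \tr (fan_u F i) = 0
        & posdefmx ((2^-1 * fan_C F i)%:M
                    - (tensor (fan_v F i) - fan_u F i))],
      conserved rho_bar (fun j z => rho_bar z * v_bar z 0 j) (rho_init d),
      forall k : 'I_2,
        conserved (fun z => rho_bar z * v_bar z 0 k)
          (fun j z => rho_bar z * u_bar z k j
             + (j == k)%:R * (p (rho_bar z) + 2^-1 * rho_bar z * C_bar z))
          (fun x => rho_init d x * v_init d x 0 k)
    & dissipated (H_bar e)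
        (fun j z => (H_bar e z + p (rho_bar z)) * v_bar z 0 j)
        (fun x => energy e (rho_init d x) (v_init d x))].

Definition fan_identities (rho : R * R * R -> R) (v : R * R * R -> 'rV[R]_2)
    (z : R * R * R) : Prop :=
  [/\ rho z = rho_bar z,
      P_minus F z -> v z = v_minus d,
      P_plus F z -> v z = v_plus d
    & forall i, P_mid F i z -> normsq (v z) = fan_C F i].

Definition convex_integration_realization (p e : R -> R)
    (rho : R * R * R -> R) (v : R * R * R -> 'rV[R]_2) : Prop :=
  bounded_entropic_weak_solution p e d rho v /\
  {ae lebesgue3, forall z, future z -> fan_identities rho v z}.

(* The almost-everywhere identities on the time slice [t], which the space-time
   version only yields for almost every [t]. *)
Definition realized_at (rho : R * R * R -> R) (v : R * R * R -> 'rV[R]_2)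
    (t : R) : Prop :=
  {ae lebesgue2, forall x, fan_identities rho v (x, t)}.

Definition H_fan (e : R -> R) (xi : R) : R :=
  fan_profile F (energy e (rho_minus d) (v_minus d))
    (energy e (rho_plus d) (v_plus d))
    (fun i => 2^-1 * fan_rho F i * fan_C F i + fan_rho F i * e (fan_rho F i)) xi.

End FanFields.

Record self_similar (M : nat) := SelfSimilar {
  ref_rho : 'I_M -> R;
  ref_v : 'I_M -> 'rV[R]_2;
  ref_sigma : 'I_M.+1 -> \bar R }.

Definition in_sector M (S : self_similar M) (j : 'I_M) (xi : R) : bool :=
  (ref_sigma S (left_end j) < xi%:E < ref_sigma S (right_end j))%E.

(* The Riemann data are the states of the two unbounded sectors; the values of
   [rho] and [v] on the rays separating the sectors are left free. *)
Definition reference_solution M (S : self_similar M) (p : R -> R)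
    (d : riemann_data) (rho : R * R * R -> R) (v : R * R * R -> 'rV[R]_2) :
    Prop :=
  [/\ [/\ ref_sigma S ord0 = -oo%E, ref_sigma S ord_max = +oo%E
        & {homo ref_sigma S : i j / (i < j)%N >-> (i < j)%E}],
      forall j, 0 < ref_rho S j,
      forall j,
        (ref_sigma S (left_end j) = -oo%E ->
           ref_rho S j = rho_minus d /\ ref_v S j = v_minus d) /\
        (ref_sigma S (right_end j) = +oo%E ->
           ref_rho S j = rho_plus d /\ ref_v S j = v_plus d),
      forall (z : R * R * R) j, 0 < z.2 -> in_sector S j (z.1.2 / z.2) ->
        rho z = ref_rho S j /\ v z = ref_v S j
    & euler_weak_solution p d rho v].

Definition H_ref M (S : self_similar M) (e : R -> R) (xi : R) : R :=
  if [pick j | in_sector S j xi] is Some j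
  then energy e (ref_rho S j) (ref_v S j) else 0.

Definition energy_excess N M (F : fan N) (S : self_similar M)
    (d : riemann_data) (e : R -> R) : R :=
  \int[lebesgue_measure]_xi (H_fan F d e xi - H_ref S e xi).

(* [0, l[ x R is a fundamental domain of (R / l Z) x R. *)
Definition strip (l : R) : set (R * R) := `[0, l[ `*` setT.

Definition energy_diff (e : R -> R) (l : R)
    (rho1 : R * R * R -> R) (v1 : R * R * R -> 'rV[R]_2)
    (rho2 : R * R * R -> R) (v2 : R * R * R -> 'rV[R]_2) (t : R) : \bar R :=
  (\int[lebesgue2]_(x in strip l)
     (energy e (rho1 (x, t)) (v1 (x, t))
      - energy e (rho2 (x, t)) (v2 (x, t)))%:E)%E.

Definition is_right_derive (f : R -> R) (t df : R) : Prop :=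
  h^-1 * (f (t + h) - f t) @[h --> 0^'+] --> df.

Definition smaller_energy_rate e l rho1 v1 rho2 v2 (t : R) : Prop :=
  exists2 r : R,
    is_right_derive (fun s => fine (energy_diff e l rho1 v1 rho2 v2 s)) t r
    & r < 0.
Definition larger_energy_rate e l rho1 v1 rho2 v2 (t : R) : Prop :=
  exists2 r : R,
    is_right_derive (fun s => fine (energy_diff e l rho1 v1 rho2 v2 s)) t r
    & 0 < r.

End Euler.

Arguments riemann_data : clear implicits.
Arguments fan : clear implicits.
Arguments self_similar : clear implicits.

(* Main.v *)
Require Import Defs.
From HB Require Import structures.
From mathcomp Require Import all_boot all_order all_algebra.
From mathcomp Require Import all_classical all_reals all_analysis.
From mathcomp Require Import measurable_realfun.

Set Implicit Arguments.
Unset Strict Implicit.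
Unset Printing Implicit Defensive.

Import Order.TTheory GRing.Theory Num.Theory.
Import numFieldNormedType.Exports.

Local Open Scope classical_set_scope.
Local Open Scope ring_scope.

(** The formula holds because both energies are functions of the slope
    [x.2 / t] alone.  At a time [t > 0] where the almost-everywhere identities
    hold, the energy density of a realization depends on [v] only through
    [normsq v], which the fan prescribes in every sector, and the density of
    the reference solution is constant in every sector.  Hence, off the
    finitely many rays separating the sectors, the integrand of [energy_diff]
    is the profile [H_fan - H_ref] evaluated at [x.2 / t]
    ([energy_realization], [energy_reference], [ae_off_rays]).  Integrating
    over the strip and rescaling the vertical variable gives the factor
    [l * t] ([integral_strip]).

    The profile is integrable because it is a bounded step function that
    vanishes far from the origin, where both solutions are in the state given
    by the Riemann data ([H_diff_support], [H_diff_integrable]).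

    The energy difference is thus linear in time, with slope
    [l * energy_excess], wherever the identities hold.  If they hold from
    [t] until some later time, that slope is the right derivative at [t], and since
    [0 < l] it has the sign of the energy excess
    ([energy_diff_right_derive]).

    The integrand of [energy_diff] need not be measurable: a reference
    solution is arbitrary on the rays, and a realization is only known up to a
    null set of the slice.  Replacing it by the profile therefore requires
    that the integral ignore null sets for arbitrary functions
    ([ae_integral_eq]). *)

(** * Integrals of functions that need not be measurable *)

Section ae_integral.
Local Open Scope ereal_scope.
Context d (T : measurableType d) (R : realType).
Variable mu : {measure set T -> \bar R}.
Import HBNNSimple.

(** The integral of a nonnegative function is a supremum over the simple
    functions below it.  A simple function below [f], set to zero on the
    exceptional null set, keeps its integral and lies below [g].  This
    compares the two suprema for arbitrary [f] and [g]. *)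
Lemma ge0_ae_le_integralT (f g : T -> \bar R) :
  (forall x, 0 <= f x) -> (forall x, 0 <= g x) ->
  {ae mu, forall x, f x <= g x} -> \int[mu]_x f x <= \int[mu]_x g x.
Proof.
move=> f0 g0 [N [mN muN0 fgN]].
rewrite ge0_integralTE// [leRHS]ge0_integralTE//.
apply: ge_ereal_sup => _ [h hf <-].
have mNC : measurable (~` N) by exact: measurableC.
apply: ereal_sup_ubound; exists (proj_nnsfun h mNC).
  move=> x; rewrite /proj_nnsfun/= mindicE.
  have [xN|xN] := boolP (x \in ~` N); last by rewrite mulr0.
  rewrite mulr1; apply: le_trans (hf x) _; apply: contrapT => nfg.
  by move: xN; rewrite inE; apply; exact: fgN.
rewrite -!integralT_nnsfun; apply: ge0_ae_eq_integral => //.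
- exact/measurable_EFinP.
- exact/measurable_EFinP.
- by move=> x _; rewrite lee_fin.
- by move=> x _; rewrite lee_fin.
exists N; split=> // x /= /not_implyP[_].
rewrite /proj_nnsfun/= mindicE.
have [xN|] := boolP (x \in ~` N); first by rewrite mulr1.
by rewrite notin_setE => /contrapT.
Qed.

Lemma ae_integral_eq (D : set T) (f g : T -> \bar R) :
  {ae mu, forall x, D x -> f x = g x} ->
  \int[mu]_(x in D) f x = \int[mu]_(x in D) g x.
Proof.
move=> fg; rewrite integral_mkcond [RHS]integral_mkcond.
have {}fg : {ae mu, forall x, (f \_ D) x = (g \_ D) x}.
  apply: filterS fg => x fg; rewrite !patchE.
  by case: ifPn => // /set_mem /fg.
rewrite integralE [RHS]integralE.
by congr (_ - _); apply/eqP; rewrite eq_le; apply/andP; split;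
  apply: ge0_ae_le_integralT => //; apply: filterS fg => x; rewrite /= => fgx;
  rewrite unlock fgx.
Qed.
End ae_integral.

(** * Integrals over the strip *)

Section strip_integral.
Local Open Scope ereal_scope.
Context {R : realType}.
Notation mu := (@lebesgue_measure R).

(** The image of Lebesgue measure under [y => y / t], multiplied by [t^-1],
    gives a half-open interval its length, so it is Lebesgue measure again. *)
Lemma ge0_integral_rescale (t : R) (g : R -> \bar R) : (0 < t)%R ->
  measurable_fun setT g -> (forall x, 0 <= g x) ->
  \int[mu]_y g (y / t)%R = t%:E * \int[mu]_y g y.
Proof.
move=> t0 mg g0.
have tV0 : (0 <= t^-1)%R by rewrite invr_ge0 ltW.
pose phi : R -> measurableTypeR R := fun y => (y / t)%R.
have mphi : measurable_fun setT phi by exact: mulrr_measurable.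
transitivity (\int[pushforward mu phi]_y g y).
  by rewrite ge0_integral_pushforward.
rewrite (_ : \int[mu]_y g y =
    \int[mscale (NngNum tV0) (pushforward mu phi)]_y g y).
  by rewrite ge0_integral_mscale// muleA/= -EFinM divff ?mul1e// gt_eqF.
apply: eq_measure_integral => A mA _; apply: lebesgue_measure_unique => //.
move=> _ [[a b]] _ <-; rewrite /= /mscale /= /pushforward.
rewrite (_ : _ @^-1` _ = `]a * t, b * t]%classic%R); last first.
  by apply/seteqP; split=> y /=; rewrite !in_itv/= ltr_pdivlMr// ler_pdivrMr.
rewrite !lebesgue_measure_itv/= !lte_fin ltr_pM2r//.
case: ifPn => _; last by rewrite mule0.
by rewrite -!EFinB -EFinM -mulrBl mulrC mulfK// gt_eqF.
Qed.

(** By Tonelli's theorem: the indicator of [[0, l[] contributes the factor [l],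
    the vertical rescaling the factor [t]. *)
Lemma ge0_integral_strip (l t : R) (g : R -> \bar R) : (0 < l)%R -> (0 < t)%R ->
  measurable_fun setT g -> (forall x, 0 <= g x) ->
  \int[@lebesgue2 R]_(x in strip l) g (x.2 / t)%R =
  (l * t)%:E * \int[mu]_y g y.
Proof.
move=> l0 t0 mg g0.
rewrite integral_mkcond.
have mgt : measurable_fun setT (fun y : R => g (y / t)%R).
  by apply: measurableT_comp mg _; exact: mulrr_measurable.
pose f (x : measurableTypeR R * measurableTypeR R) :=
  (\1_(`[0%R, l[ : set (measurableTypeR R)) x.1)%:E * g (x.2 / t)%R.
have mf : measurable_fun setT f.
  apply: emeasurable_funM.
    apply/measurable_EFinP.
    by apply: measurableT_comp => //; exact: measurable_indic.
  by apply: (measurableT_comp mgt); exact: measurable_snd.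
transitivity (\int[@lebesgue2 R]_x f x).
  apply: eq_integral => x _; rewrite patchE /f indicE /strip.
  have [xl|xl] := boolP (x.1 \in `[0%R, l[%classic).
    by rewrite ifT ?mul1e// inE; split=> //; exact: set_mem xl.
  rewrite ifF ?mul0e//; apply/negP => /set_mem[xl' _].
  by move/negP: xl; apply; exact: mem_set.
rewrite fubini_tonelli1//; last first.
  by move=> x; rewrite /f mule_ge0// lee_fin.
rewrite /fubini_F /f /=.
under eq_integral do rewrite ge0_integralZl//.
have ml : mu (`[0%R, l[%classic : set R) = l%:E.
  by rewrite lebesgue_measure_itv/= lte_fin l0 sube0.
rewrite ge0_integralZr//; [|exact/measurable_EFinP/measurable_indic|
  exact: integral_ge0].
rewrite integral_indic// setIT ge0_integral_rescale//.
by rewrite [X in X * _]ml muleA -EFinM.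
Qed.

(** Integrability of [g] makes the integrals of its positive and negative
    parts finite, which is what lets [l * t] distribute over their
    difference. *)
Lemma integral_strip (l t : R) (g : R -> R) : (0 < l)%R -> (0 < t)%R ->
  mu.-integrable setT (EFin \o g) ->
  \int[@lebesgue2 R]_(x in strip l) (g (x.2 / t)%R)%:E =
  (l * t * \int[mu]_y g y)%:E.
Proof.
move=> l0 t0 ig; have mg := measurable_int _ ig.
have finE h : mu.-integrable setT h ->
    (\int[mu]_y h y \is a fin_num)%E by exact: integrable_fin_num.
rewrite EFinM /Rintegral fineK ?finE//.
rewrite [LHS]integralE [X in (_ * X)]integralE muleBr//; last first.
  apply: fin_num_adde_defl; rewrite fin_numN finE//.
  exact: integrable_funeneg.
congr (_ - _)%E.
  rewrite -ge0_integral_strip//; last exact: measurable_funepos.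
  by apply: eq_integral => x _; rewrite unlock.
rewrite -ge0_integral_strip//; last exact: measurable_funeneg.
by apply: eq_integral => x _; rewrite unlock.
Qed.

Lemma ae_snd_neq (c : R) : {ae @lebesgue2 R, forall x, x.2 <> c}.
Proof.
exists (setT `*` [set c]); split.
- by apply: measurableX => //; exact: measurable_set1.
- by rewrite [LHS]product_measure1E//= lebesgue_measure_set1 mule0.
- by move=> x /= /contrapT ->.
Qed.

(** The filter structure on almost-everywhere statements is keyed on the form
    of the measure and does not see through the name [lebesgue2]. *)
#[local] Instance ae_lebesgue2_filter :
  Filter (nbhs (almost_everywhere (@lebesgue2 R))).
Proof. by rewrite /lebesgue2; exact: ae_filter_ringOfSetsType. Qed.

End strip_integral.
#[local] Existing Instance ae_lebesgue2_filter.

(** * Piecewise constant profiles *)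

Lemma measurable_pick d (T : measurableType d) (R : realType) (I : finType)
  (P : I -> T -> bool) (a : I -> R) :
  (forall i, measurable_fun setT (P i)) ->
  measurable_fun setT
    (fun x => if [pick i | P i x] is Some i then a i else 0 : R).
Proof.
move=> mP.
(* [pick] is the head of a filtered enumeration: a finite cascade of tests. *)
rewrite /pick /enum_mem.
elim: (Finite.enum _) => [|i s IH]/=; first exact: measurable_cst.
rewrite (_ : (fun x => _) = fun x => if P i x then a i else
  if ohead [seq i <- s | P i x] is Some i then a i else 0).
  exact: measurable_fun_ifT.
apply/funext => x /=.
by rewrite unfold_in /=; case: (P i x).
Qed.

Lemma pick_bounded (R : realType) (I : finType) (P : pred I) (a : I -> R) :
  `|if [pick i | P i] is Some i then a i else 0| <= \sum_i `|a i|.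
Proof.
case: pickP => [i _|_]; last by rewrite normr0 sumr_ge0.
by rewrite (bigD1 i)//= lerDl sumr_ge0.
Qed.

(** A discrete intermediate value argument: at the first subdivision point above
    [x], the preceding one is still below [x].  Stated over any total order so
    that it serves both the real speeds of a fan and the extended real ones of
    a reference solution. *)
Lemma subdivision_interval dT (T : orderType dT) n (b : 'I_n.+1 -> T) (x : T) :
  (b ord0 < x)%O -> (x < b ord_max)%O -> (forall i, x <> b i) ->
  exists i : 'I_n, (b (left_end i) < x < b (right_end i))%O.
Proof.
move=> b0 bn xb.
have ex : exists k, (k <= n)%N && (x < b (inord k))%O.
  exists n; rewrite leqnn/= (_ : inord n = ord_max)//.
  by apply/val_inj; rewrite /= inordK.
case: (ex_minnP ex) => -[|k] /andP[kn xk] mink.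
  move: xk; rewrite (_ : inord 0 = ord0); last first.
    by apply/val_inj; rewrite /= inordK.
  by rewrite ltNge (ltW b0).
exists (Ordinal kn); apply/andP; split; last first.
  by rewrite (_ : right_end _ = inord k.+1)//; apply/val_inj; rewrite /= inordK.
rewrite (_ : left_end _ = inord k); last first.
  by apply/val_inj; rewrite /= inordK// ltnW.
rewrite lt_neqAle; apply/andP; split; first by apply/eqP => /esym/xb.
rewrite leNgt; apply/negP => xk'.
by have := mink k; rewrite (ltnW kn) xk' ltnn => /(_ isT).
Qed.

(** * Energy densities as functions of the slope *)

Section energy.
Context {R : realType}.
Notation mu := (@lebesgue_measure R).

Variables (p e : R -> R) (d : riemann_data R).

Section fan.
Variables (N : nat) (F : fan R N).

(** [rho_bar] and [H_fan] select the sector of the slope by the same choice, so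
    the identities evaluate the density in the very sector that [H_fan] picks;
    the only slopes for which no sector is picked are the interface speeds. *)
Lemma energy_realization (rho : R * R * R -> R) (v : R * R * R -> 'rV[R]_2)
    (x : R * R) (t : R) : 0 < t -> fan_identities F d rho v (x, t) ->
  (forall i, x.2 / t <> fan_nu F i) ->
  energy e (rho (x, t)) (v (x, t)) = H_fan F d e (x.2 / t).
Proof.
move=> t0 [rhoE vm vp vi] xnu; move: rhoE.
rewrite /rho_bar /H_fan /fan_profile/=.
case: ifPn => [xm ->|].
  by rewrite vm//; split=> //=; rewrite -ltr_pdivrMr.
rewrite -leNgt => mx.
case: ifPn => [xp ->|].
  by rewrite vp//; split=> //=; rewrite -ltr_pdivlMr.
rewrite -leNgt => xp.
case: pickP => [i /andP[li ri] ->|none].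
  rewrite /energy (vi i)//; split=> //=.
    by rewrite -ltr_pdivlMr.
  by rewrite -ltr_pdivrMr.
have l0 : fan_nu F ord0 < x.2 / t.
  by rewrite lt_neqAle mx andbT; apply/eqP => /esym/xnu.
have rN : x.2 / t < fan_nu F ord_max.
  by rewrite lt_neqAle xp andbT; apply/eqP => /xnu.
by have [i] := subdivision_interval l0 rN xnu; rewrite none.
Qed.

Lemma measurable_H_fan : measurable_fun setT (H_fan F d e).
Proof.
rewrite /H_fan /fan_profile.
apply: measurable_fun_ifT; [exact: measurable_fun_ltr|exact: measurable_cst|].
apply: measurable_fun_ifT; [exact: measurable_fun_ltr|exact: measurable_cst|].
apply: measurable_pick => i.
by apply: measurable_and; exact: measurable_fun_ltr.
Qed.

End fan.

Section ref.
Variables (M : nat) (S : self_similar R M).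

Lemma measurable_H_ref : measurable_fun setT (H_ref S e).
Proof.
apply: measurable_pick => i.
apply: measurable_and; apply: measurable_fun_lte => //;
  exact: EFin_measurable.
Qed.

Lemma H_ref_sector (xi : R) :
  ref_sigma S ord0 = -oo%E -> ref_sigma S ord_max = +oo%E ->
  (forall j, xi%:E <> ref_sigma S j) ->
  exists2 j, in_sector S j xi &
    H_ref S e xi = energy e (ref_rho S j) (ref_v S j).
Proof.
move=> s0 sM ns; rewrite /H_ref; case: pickP => [j jx|none]; first by exists j.
have [||j] := subdivision_interval (b := ref_sigma S) (x := xi%:E) _ _ ns.
- by rewrite s0 ltNyr.
- by rewrite sM ltry.
- by rewrite -/(in_sector S j xi) none.
Qed.

Lemma energy_reference (rho : R * R * R -> R) (v : R * R * R -> 'rV[R]_2)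
    (x : R * R) (t : R) : 0 < t -> reference_solution S p d rho v ->
  (forall j, (x.2 / t)%:E <> ref_sigma S j) ->
  energy e (rho (x, t)) (v (x, t)) = H_ref S e (x.2 / t).
Proof.
move=> t0 [[s0 sM _] _ _ sol _] ns.
have [j xj ->] := H_ref_sector s0 sM ns.
by have [-> ->] := sol (x, t) j t0 xj.
Qed.
End ref.

Variables (N M : nat) (F : fan R N) (S : self_similar R M).
Variables (rho_ref : R * R * R -> R) (v_ref : R * R * R -> 'rV[R]_2).
Hypothesis ref : reference_solution S p d rho_ref v_ref.

(** A slope larger in modulus than every finite interface speed lies in an
    unbounded sector of both solutions, where the state is the Riemann
    datum. *)
Lemma H_diff_support : exists K : R,
  forall xi, K < `|xi| -> H_fan F d e xi = H_ref S e xi.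
Proof.
(* [fine] sends the two infinite end points to 0, so they do not affect the
   bound. *)
pose K := \sum_(i < N.+1) `|fan_nu F i| +
  \sum_(j < M.+1) `|fine (ref_sigma S j)|.
exists K => xi Kxi.
have nuK i : `|fan_nu F i| < `|xi|.
  apply: le_lt_trans Kxi; rewrite /K (bigD1 i)//= -addrA lerDl.
  by rewrite addr_ge0// sumr_ge0.
have sK j : `|fine (ref_sigma S j)| < `|xi|.
  apply: le_lt_trans Kxi; rewrite /K (bigD1 j)//= addrCA lerDl.
  by rewrite addr_ge0// sumr_ge0.
have [[s0 sM _] _ ends _ _] := ref.
have [|j /andP[lj rj] ->] := H_ref_sector s0 sM (xi := xi).
  by move=> j jE; have := sK j; rewrite -jE/= ltxx.
rewrite /H_fan /fan_profile.
have [xi0|xi0] := ltP xi 0.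
  have lNy : ref_sigma S (left_end j) = -oo%E.
    move: lj (sK (left_end j)); case: (ref_sigma S _) => [r||]//=.
    rewrite lte_fin => rx; rewrite (ltr0_norm xi0) ltr_norml opprK.
    case/andP=> xr _.
    by have := lt_trans rx xr; rewrite ltxx.
  have [-> ->] := (ends j).1 lNy.
  rewrite ifT//; have := nuK ord0.
  by rewrite (ltr0_norm xi0) ltr_norml opprK => /andP[].
have rNy : ref_sigma S (right_end j) = +oo%E.
  move: rj (sK (right_end j)); case: (ref_sigma S _) => [r||]//=.
  rewrite lte_fin => rx; rewrite (ger0_norm xi0) ltr_norml => /andP[_ xr].
  by have := lt_trans rx xr; rewrite ltxx.
have [-> ->] := (ends j).2 rNy.
have := nuK ord0; have := nuK ord_max; rewrite (ger0_norm xi0) !ltr_norml.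
move=> /andP[_ xr] /andP[_ xl].
by rewrite ifF ?ifT//; apply/negbTE; rewrite -leNgt ltW.
Qed.

(** On the interval that contains its support, of finite measure, the profile
    is bounded by the sum of all the values it is built from. *)
Lemma H_diff_integrable :
  mu.-integrable setT (EFin \o (fun xi => H_fan F d e xi - H_ref S e xi)).
Proof.
have mH : measurable_fun setT (fun xi => H_fan F d e xi - H_ref S e xi).
  by apply: measurable_funB; [exact: measurable_H_fan|exact: measurable_H_ref].
have [K suppK] := H_diff_support.
have finK : (mu (`[(- K)%R, K%R]%classic : set R) < +oo)%E.
  by rewrite lebesgue_measure_itv/=; case: ifPn => // _; rewrite -EFinB ltry.
pose g := fun xi => H_fan F d e xi - H_ref S e xi.
have -> : EFin \o g = (EFin \o g) \_ `[- K, K]%classic.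
  apply/funext => xi; rewrite patchE; case: ifPn => // /negP xiK /=.
  rewrite /g suppK ?subrr// ltNge; apply/negP; rewrite ler_norml => xiK'.
  by apply: xiK; rewrite inE/= in_itv.
apply: (integrable_mkcond _ _).1 => //.
apply: measurable_bounded_integrable => //.
- exact: measurable_funTS.
pose fanB := `|energy e (rho_minus d) (v_minus d)| +
  `|energy e (rho_plus d) (v_plus d)| +
  \sum_i `|2^-1 * fan_rho F i * fan_C F i + fan_rho F i * e (fan_rho F i)|.
exists (fanB + \sum_j `|energy e (ref_rho S j) (ref_v S j)|).
split=> [|B ltB xi _]; first exact: num_real.
apply: le_trans (ltW ltB); apply: le_trans (ler_normB _ _) _.
apply: lerD; last exact: pick_bounded.
rewrite /H_fan /fan_profile /fanB; case: ifPn => _.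
  by rewrite -addrA lerDl addr_ge0// sumr_ge0.
case: ifPn => _; first by rewrite addrAC lerDr addr_ge0// sumr_ge0.
by apply: le_trans (pick_bounded _ _) _; rewrite lerDr addr_ge0.
Qed.

Lemma ae_off_rays (t : R) : 0 < t ->
  {ae @lebesgue2 R, forall x, (forall i, x.2 / t <> fan_nu F i) /\
     (forall j, (x.2 / t)%:E <> ref_sigma S j)}.
Proof.
move=> t0.
have H1 (r : R) : {ae @lebesgue2 R, forall x, x.2 / t <> r}.
  apply: filterS (ae_snd_neq (r * t)) => x xrt xr; apply: xrt.
  by rewrite -xr divfK// gt_eqF.
have H2 (r : \bar R) : {ae @lebesgue2 R, forall x, (x.2 / t)%:E <> r}.
  case: r => [r||]; [|exact: aeW|exact: aeW].
  by apply: filterS (H1 r) => x xr [].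
have nu_ae : {ae @lebesgue2 R, forall x, forall i, x.2 / t <> fan_nu F i}.
  by apply: filter_forall => i; exact: H1.
have sigma_ae :
    {ae @lebesgue2 R, forall x, forall j, (x.2 / t)%:E <> ref_sigma S j}.
  by apply: filter_forall => i; exact: H2.
exact: filterI.
Qed.

(** * The energy difference and its rate *)

Variables (rho : R * R * R -> R) (v : R * R * R -> 'rV[R]_2).

Lemma energy_diffE (l t : R) : 0 < l -> 0 < t -> realized_at F d rho v t ->
  energy_diff e l rho v rho_ref v_ref t = (l * t * energy_excess F S d e)%:E.
Proof.
move=> l0 t0 rt.
rewrite /energy_excess -integral_strip//; last exact: H_diff_integrable.
apply: ae_integral_eq.
apply: filterS2 rt (ae_off_rays t0) => x idx [xnu xs] _.
by rewrite (energy_realization t0 idx)// (energy_reference t0 ref).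
Qed.

(** Every difference quotient with a small positive step equals
    [l * energy_excess], so the right derivative exists, and limits are
    unique. *)
Lemma energy_diff_right_derive (l t r : R) : 0 < l -> 0 < t ->
  (\forall s \near t, t <= s -> realized_at F d rho v s) ->
  is_right_derive (fun s => fine (energy_diff e l rho v rho_ref v_ref s)) t r
  <-> r = l * energy_excess F S d e.
Proof.
move=> l0 t0 real; set EE := energy_excess F S d e.
have lin : is_right_derive
    (fun s => fine (energy_diff e l rho v rho_ref v_ref s)) t (l * EE).
  apply: cvg_near_cst.
  have rt : realized_at F d rho v t by have /nbhs_singleton := real; exact.
  case: real => eps /= eps0 real.
  near=> h.
  have h0 : 0 < h by [].
  have rth : realized_at F d rho v (t + h).
    apply: real; last by rewrite lerDl ltW.
    by rewrite /= opprD addNKr normrN gtr0_norm.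
  rewrite !energy_diffE ?addr_gt0//=.
  by rewrite -mulrBl -mulrBr (addrC t) addrK (mulrC l) -mulrA mulKf// gt_eqF.
split=> [rd|->//]; exact: cvg_unique rd lin.
Unshelve. all: by end_near. Qed.

End energy.

Theorem theorem3p1 (R : realType) (p e : R -> R) (d : riemann_data R)
    (N M : nat) (F : fan R N) (S : self_similar R M)
    (rho : R * R * R -> R) (v : R * R * R -> 'rV[R]_2)
    (rho_ref : R * R * R -> R) (v_ref : R * R * R -> 'rV[R]_2) :
  pressure_law p e ->
  0 < rho_minus d -> 0 < rho_plus d ->
  admissible_fan_subsolution F d p e ->
  convex_integration_realization F d p e rho v ->
  reference_solution S p d rho_ref v_ref ->
  let EE := energy_excess F S d e in
  [/\ lebesgue_measure.-integrable [set: R]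
        (fun xi => (H_fan F d e xi - H_ref S e xi)%:E),
      forall l t : R, 0 < l -> 0 < t -> realized_at F d rho v t ->
        energy_diff e l rho v rho_ref v_ref t = (l * t * EE)%:E
    & forall l t : R, 0 < l -> 0 < t ->
        (\forall s \near t, t <= s -> realized_at F d rho v s) ->
        (smaller_energy_rate e l rho v rho_ref v_ref t <-> EE < 0) /\
        (larger_energy_rate e l rho v rho_ref v_ref t <-> 0 < EE)].
Proof.
move=> _ _ _ _ _ ref EE; split.
- exact: (H_diff_integrable e F ref).
- by move=> l t l0 t0; exact: (energy_diffE e ref).
move=> l t l0 t0 real.
have deriv r := energy_diff_right_derive e ref r l0 t0 real.
rewrite -(pmulr_rlt0 EE l0) -(pmulr_rgt0 EE l0); split; split.
- by case=> r /deriv ->.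
- by exists (l * EE) => //; exact/deriv.
- by case=> r /deriv ->.
- by exists (l * EE) => //; exact/deriv.
Qed.
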